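(* Let $L$ be a vector space. The bracket $[\cdot,\cdot]_{\rm 3-LieDer}:\mathcal{C}^{p}_{\rm 3-LieDer}(L;L)\times \mathcal{C}^{q}_{\rm 3-LieDer}(L;L)\to \mathcal{C}^{p+q-1}_{\rm 3-LieDer}(L;L)$ given by $$[(\alpha_p,\beta_{p-1}),(\alpha_q,\beta_{q-1})]_{\rm 3-LieDer}=\big([\alpha_p,\alpha_q]_{\rm 3Lie},\ (-1)^{p+1}[\alpha_p,\beta_{q-1}]_{\rm 3Lie}+[\beta_{p-1},\alpha_q]_{\rm 3Lie}\big)$$ defines a degree $-1$ graded Lie bracket on the graded vector space $\mathcal{C}^{\ast}_{\rm 3-LieDer}(L;L)=\bigoplus_{p\ge 1}\mathcal{C}^{p}_{\rm 3-LieDer}(L;L)$. Moreover, its Maurer-Cartan elements are precisely the 3-LieDer pairs on $L$; that is, for $\omega\in\mathrm{Hom}(\wedge^3L,L)$ and $\varphi\in\mathrm{Hom}(L,L)$, one has $[(\omega,\varphi),(\omega,\varphi)]_{\rm 3-LieDer}=0$ if and only if $(L,\omega,\varphi)$ is a 3-LieDer pair.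
   Context: Throughout, $\mathbb F$ is an algebraically closed field of characteristic $0$ and all vector spaces are finite-dimensional over $\mathbb F$. A 3-Lie algebra is a vector space $L$ with a skew-symmetric trilinear map $[\cdot,\cdot,\cdot]_L$ satisfying $[x_1,x_2,[x_3,x_4,x_5]]=[[x_1,x_2,x_3],x_4,x_5]+[x_3,[x_1,x_2,x_4],x_5]+[x_3,x_4,[x_1,x_2,x_5]]$. A derivation is a linear map $\theta:L\to L$ with $\theta[x,y,z]=[\theta x,y,z]+[x,\theta y,z]+[x,y,\theta z]$. A 3-LieDer pair is a 3-Lie algebra together with a derivation of it. For a vector space $L$, put $C^1(L;L)=\mathrm{Hom}(L,L)$ and, for $n\ge 2$, $C^n(L;L)=\mathrm{Hom}(\otimes^{n-1}(\wedge^2L)\wedge L,L)$, i.e. linear maps $f(\mathfrak X_1,\dots,\mathfrak X_{n-1},z)$ with $\mathfrak X_i=x_i\wedge y_i\in\wedge^2L$, $z\in L$, that are totally skew-symmetric in the last three arguments $x_{n-1},y_{n-1},z$ (so $C^n(L;L)=\mathrm{Hom}((\wedge^2L)^{\otimes (n-2)}\otimes\wedge^3L,L)$). Put $C^0(L;L)=0$. Let $\mathbb S_{(i,j)}$ be the set of $(i,j)$-shuffles in the symmetric group on $i+j$ letters ($\sigma(1)<\dots<\sigma(i)$, $\sigma(i+1)<\dots<\sigma(i+j)$; only the identity if $i=0$ or $j=0$), and $(-1)^\sigma$ the sign of $\sigma$. For $P\in C^{p+1}(L;L)$, $Q\in C^{q+1}(L;L)$ define $P\circ Q\in C^{p+q+1}(L;L)$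 by $$\begin{aligned}(P\circ Q)&(\mathfrak X_1,\dots,\mathfrak X_{p+q},z)\\ =&\sum_{k=1}^{p}(-1)^{(k-1)q}\sum_{\sigma\in\mathbb S_{(k-1,q)}}(-1)^\sigma P\big(\mathfrak X_{\sigma(1)},\dots,\mathfrak X_{\sigma(k-1)},Q(\mathfrak X_{\sigma(k)},\dots,\mathfrak X_{\sigma(k+q-1)},x_{k+q})\wedge y_{k+q},\mathfrak X_{k+q+1},\dots,\mathfrak X_{p+q},z\big)\\ &+\sum_{k=1}^{p}(-1)^{(k-1)q}\sum_{\sigma\in\mathbb S_{(k-1,q)}}(-1)^\sigma P\big(\mathfrak X_{\sigma(1)},\dots,\mathfrak X_{\sigma(k-1)},x_{k+q}\wedge Q(\mathfrak X_{\sigma(k)},\dots,\mathfrak X_{\sigma(k+q-1)},y_{k+q}),\mathfrak X_{k+q+1},\dots,\mathfrak X_{p+q},z\big)\\ &+\sum_{\sigma\in\mathbb S_{(p,q)}}(-1)^{pq}(-1)^\sigma P\big(\mathfrak X_{\sigma(1)},\dots,\mathfrak X_{\sigma(p)},Q(\mathfrak X_{\sigma(p+1)},\dots,\mathfrak X_{\sigma(p+q)},z)\big),\end{aligned}$$ and $[P,Q]_{\rm 3Lie}=P\circ Q-(-1)^{pq}Q\circ P$. It is known (Rotkiewicz) that $[\cdot,\cdot]_{\rm 3Lie}$ is a degree $-1$ graded Lie bracket on $C^*(L;L)=\bigoplus_{n\ge1}C^n(L;L)$ and that $\pi\in\mathrm{Hom}(\wedge^3L,L)$ is a 3-Lie bracket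 iff $[\pi,\pi]_{\rm 3Lie}=0$. ''Degree $-1$ graded Lie bracket'' on $\bigoplus_{p\ge1}C^p$ means a bilinear bracket $C^p\times C^q\to C^{p+q-1}$ which is a graded Lie bracket (graded skew-symmetric, graded Jacobi identity) when elements of $C^p$ are assigned degree $p-1$. Cochain spaces: $\mathcal C^1_{\rm 3-LieDer}(L;L)=\mathrm{Hom}(L,L)$ (an element $\alpha_1$ being regarded as $(\alpha_1,0)$) and $\mathcal C^p_{\rm 3-LieDer}(L;L)=C^p(L;L)\times C^{p-1}(L;L)$ for $p\ge2$. A Maurer-Cartan element is an element $m\in\mathcal C^2_{\rm 3-LieDer}(L;L)=\mathrm{Hom}(\wedge^3L,L)\times\mathrm{Hom}(L,L)$ with $[m,m]_{\rm 3-LieDer}=0$. *)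

(* Defs.v *)
From HB Require Import structures.
From mathcomp Require Import all_boot all_order all_algebra all_fingroup.
From mathcomp Require Import boolp functions.

Set Implicit Arguments.
Unset Strict Implicit.
Unset Printing Implicit Defensive.

Import GRing.Theory.
Local Open Scope ring_scope.

Section GradedLie.
Variables (F : fieldType) (V : lmodType F).

Definition is_subspace (S : V -> Prop) : Prop :=
  S 0 /\ forall (a : F) (u v : V), S u -> S v -> S (a *: u + v).

(* A degree -1 graded Lie bracket on the external direct sum of the spaces
   S 1, S 2, ..., all given as subspaces of one ambient space V, so that the
   two sides of the identities below can be compared without transport along
   equalities between degrees.  [b p q] is the component S p x S q -> S (p+q-1)
   of the bracket; only its values on S p x S q with p, q >= 1 matter.  For the
   signs, elements of S p have degree p - 1. *)
Record graded_Lie_bracket (S : nat -> V -> Prop)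
    (b : nat -> nat -> V -> V -> V) : Prop := GradedLieBracket {
  graded_Lie_subspace : forall p, (0 < p)%N -> is_subspace (S p);
  graded_Lie_closed : forall p q x y, (0 < p)%N -> (0 < q)%N ->
    S p x -> S q y -> S (p + q - 1)%N (b p q x y);
  graded_Lie_linear_l : forall p q (a : F) x x' y, (0 < p)%N -> (0 < q)%N ->
    S p x -> S p x' -> S q y ->
    b p q (a *: x + x') y = a *: b p q x y + b p q x' y;
  graded_Lie_linear_r : forall p q (a : F) x y y', (0 < p)%N -> (0 < q)%N ->
    S p x -> S q y -> S q y' ->
    b p q x (a *: y + y') = a *: b p q x y + b p q x y';
  graded_Lie_skew : forall p q x y, (0 < p)%N -> (0 < q)%N ->
    S p x -> S q y ->
    b p q x y = - ((-1) ^+ ((p - 1) * (q - 1)) *: b q p y x);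
  graded_Lie_Jacobi : forall p q r x y z,
    (0 < p)%N -> (0 < q)%N -> (0 < r)%N -> S p x -> S q y -> S r z ->
    b p (q + r - 1)%N x (b q r y z) =
      b (p + q - 1)%N r (b p q x y) z
      + (-1) ^+ ((p - 1) * (q - 1)) *: b q (p + r - 1)%N y (b p r x z)
}.

End GradedLie.

Section ThreeLieDer.
Variables (F : fieldType) (L : vectType F).

Record skew_trilinear (w : L -> L -> L -> L) : Prop := SkewTrilinear {
  trilinear_1 : forall y z, linear (fun x => w x y z);
  trilinear_2 : forall x z, linear (fun y => w x y z);
  trilinear_3 : forall x y, linear (fun z => w x y z);
  skew_12 : forall x y z, w y x z = - w x y z;
  skew_23 : forall x y z, w x z y = - w x y z
}.

Record three_Lie_algebra (w : L -> L -> L -> L) : Prop := ThreeLieAlgebra {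
  three_Lie_skew : skew_trilinear w;
  three_Lie_fundamental : forall x1 x2 x3 x4 x5,
    w x1 x2 (w x3 x4 x5) =
      w (w x1 x2 x3) x4 x5 + w x3 (w x1 x2 x4) x5 + w x3 x4 (w x1 x2 x5)
}.

Definition is_derivation (w : L -> L -> L -> L) (theta : 'End(L)) : Prop :=
  forall x y z,
    theta (w x y z) = w (theta x) y z + w x (theta y) z + w x y (theta z).

Definition three_LieDer_pair (w : L -> L -> L -> L) (theta : 'End(L)) : Prop :=
  three_Lie_algebra w /\ is_derivation w theta.

(* Ambient space of all cochains.  An element f of C^n(L;L) is encoded by the
   multilinear function f [:: (x_1, y_1); ...; (x_(n-1), y_(n-1))] z, for
   f (x_1 /\ y_1, ..., x_(n-1) /\ y_(n-1), z), extended by 0 to the sequences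
   of length other than n - 1. *)
Definition precochain : Type := seq (L * L) -> L -> L.

HB.instance Definition _ := GRing.Lmodule.copy precochain
  (seq (L * L) -> L -> L).

(* [cochain n] is C^n(L;L); [cochain_size] forces C^0(L;L) = 0.  The last two
   fields give the total skew-symmetry in x_(n-1), y_(n-1), z. *)
Record cochain (n : nat) (f : precochain) : Prop := Cochain {
  cochain_size : forall X z, (size X).+1 != n -> f X z = 0;
  cochain_linear_l : forall X1 X2 y z,
    linear (fun x => f (X1 ++ (x, y) :: X2) z);
  cochain_linear_r : forall X1 X2 x z,
    linear (fun y => f (X1 ++ (x, y) :: X2) z);
  cochain_linear_last : forall X, linear (f X);
  cochain_skew : forall X1 X2 x y z,
    f (X1 ++ (y, x) :: X2) z = - f (X1 ++ (x, y) :: X2) z;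
  cochain_skew_last : forall X x y z,
    f (rcons X (x, z)) y = - f (rcons X (x, y)) z
}.

Definition is_shuffle (i j : nat) (s : 'S_(i + j)) : bool :=
  [forall a : 'I_(i + j), forall b : 'I_(i + j),
    (a < b)%N && ((b < i)%N || (i <= a)%N) ==> (s a < s b)%N].

(* X_(s(1)), ..., X_(s(i))  and  X_(s(i+1)), ..., X_(s(i+j)) *)
Definition shuffle_fst i j (s : 'S_(i + j)) (X : seq (L * L)) : seq (L * L) :=
  [seq X`_(s (lshift j a)) | a <- enum 'I_i].
Definition shuffle_snd i j (s : 'S_(i + j)) (X : seq (L * L)) : seq (L * L) :=
  [seq X`_(s (rshift i a)) | a <- enum 'I_j].

(* P o Q for P in C^(p+1) and Q in C^(q+1).  All indices start at 0: the index
   k below is the usual k - 1, and [X`_(k + q)] is (x_(k+q), y_(k+q)) in the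
   usual numbering from 1. *)
Definition circ (p q : nat) (P Q : precochain) : precochain := fun X z =>
  if size X != (p + q)%N then 0 else
  \sum_(k < p) (-1) ^+ (k * q) *:
    (\sum_(s : 'S_(k + q) | is_shuffle s) (-1) ^+ s *:
      P (shuffle_fst s X ++
         (Q (shuffle_snd s X) (X`_(k + q)).1, (X`_(k + q)).2)
         :: drop (k + q).+1 X) z)
  + \sum_(k < p) (-1) ^+ (k * q) *:
    (\sum_(s : 'S_(k + q) | is_shuffle s) (-1) ^+ s *:
      P (shuffle_fst s X ++
         ((X`_(k + q)).1, Q (shuffle_snd s X) (X`_(k + q)).2)
         :: drop (k + q).+1 X) z)
  + \sum_(s : 'S_(p + q) | is_shuffle s) (-1) ^+ (p * q) *: ((-1) ^+ s *:
      P (shuffle_fst s X) (Q (shuffle_snd s X) z)).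

(* [P, Q]_3Lie for P in C^m and Q in C^n.  When m or n is 0, the corresponding
   cochain is 0, and so is the value. *)
Definition three_Lie_bracket (m n : nat) (P Q : precochain) : precochain :=
  circ (m - 1) (n - 1) P Q
  - (-1) ^+ ((m - 1) * (n - 1)) *: circ (n - 1) (m - 1) Q P.

(* For p = 1 the second component ranges over C^0(L;L) = 0. *)
Definition LieDer_cochain (p : nat) (f : precochain * precochain) : Prop :=
  cochain p f.1 /\ cochain (p - 1) f.2.

Definition LieDer_bracket (p q : nat) (f g : precochain * precochain) :
    precochain * precochain :=
  (three_Lie_bracket p q f.1 g.1,
   (-1) ^+ (p + 1) *: three_Lie_bracket p (q - 1) f.1 g.2
   + three_Lie_bracket (p - 1) q f.2 g.1).

Definition maurer_cartan (m : precochain * precochain) : Prop :=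
  LieDer_cochain 2 m /\ LieDer_bracket 2 2 m m = 0.

Definition cochain_of_ternary (w : L -> L -> L -> L) : precochain :=
  fun X z => if X is [:: (x, y)] then w x y z else 0.

Definition cochain_of_End (phi : 'End(L)) : precochain :=
  fun X z => if X is [::] then phi z else 0.

End ThreeLieDer.

(* Main.v *)
From HB Require Import structures.
Require Import Defs.
From mathcomp Require Import all_boot all_order all_algebra all_fingroup.
From mathcomp Require Import boolp functions.
From mathcomp Require Import ring zify.

(** The bracket of cochains is the graded commutator of the composition [circ],
    and everything follows from the fact that [circ] is a graded pre-Lie
    product: its associator [(f o Q) o R - f o (Q o R)] is graded symmetric in
    [Q] and [R].  A direct proof would compare sums over pairs of shuffles.  It
    is avoided by contracting a cochain with its first pair.  In a shuffle the
    smallest letter opens one of the two blocks, so sums over shuffles obey a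
    recursion of Pascal type ([unshuffle_sum_cons]); it shows that the
    contraction with a pair is a graded derivation of the composition, except
    for a correction when [Q] is a linear map of [L], which then acts on the
    pair itself.  Together with the value on the empty sequence of pairs, this
    rule determines the composition; it is taken as the definition of
    [insertion], and [circ_insertion] proves the agreement with the shuffle
    formula.

    With the derivation rule, closure under the composition
    ([insertion_cochain]) and the symmetry of the associator
    ([associator_symmetric]) are inductions on the number of pairs, in which
    the permutations have disappeared.  The Jacobi identity for the commutator
    is then formal.

    The bracket on pairs of cochains extends the bracket of cochains by a
    parameter of degree 1 and square zero, so its axioms reduce to those for
    cochains, entry by entry.  Finally, for a ternary bracket [w] and a linear
    map [phi] the bracket of [(w, phi)] with itself is twice the pair formed by
    the defect of the fundamental identity for [w] and the defect of the
    derivation rule for [phi]; as 2 is invertible, it vanishes exactly when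
    both identities hold. *)

Set Implicit Arguments.
Unset Strict Implicit.
Unset Printing Implicit Defensive.

Import GRing.Theory.
Local Open Scope ring_scope.

(** * Sums over shuffles *)

Section Unshuffle.

Definition one_line n (s : 'S_n) : seq nat := [seq val (s a) | a <- enum 'I_n].

Lemma size_one_line n (s : 'S_n) : size (one_line s) = n.
Proof. by rewrite size_map size_enum_ord. Qed.

Lemma nth_one_line n (s : 'S_n) (a : 'I_n) : nth 0%N (one_line s) a = s a.
Proof. by rewrite (nth_map a) ?size_enum_ord// nth_ord_enum. Qed.

(** The smallest letter of a permutation of [n.+1] letters sits at some position
    [a]; deleting it leaves a permutation of [n] letters, up to shifting the
    letters by one. *)
Lemma one_line_lift_perm n (a : 'I_n.+1) (t : 'S_n) :
  one_line (lift_perm a ord0 t) =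
    map S (take a (one_line t)) ++ 0%N :: map S (drop a (one_line t)).
Proof.
have le_an : (a <= n)%N by rewrite -ltnS.
have size_take_a : size (map S (take a (one_line t))) = a.
  by rewrite size_map size_takel ?size_one_line.
apply: (@eq_from_nth _ 0%N) => [|k].
  rewrite size_cat /= size_take_a size_map size_drop !size_one_line.
  by rewrite addnS subnKC.
rewrite size_one_line => lt_kn; rewrite -[k]/(val (Ordinal lt_kn)).
rewrite nth_one_line; case: (unliftP a (Ordinal lt_kn)) => [b|] ->.
  rewrite lift_perm_lift [LHS]/= /bump add1n nth_cat size_take_a /= /bump.
  have lt_bn : (b < n)%N := ltn_ord b.
  have [le_ab|lt_ba] := leqP a b.
    rewrite add1n ltnNge leqW //= subSn //= (nth_map 0%N).
      by rewrite nth_drop subnKC ?nth_one_line.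
    by rewrite size_drop size_one_line ltn_sub2r // (leq_ltn_trans le_ab).
  rewrite add0n lt_ba (nth_map 0%N) ?size_takel ?size_one_line//.
  by rewrite nth_take ?nth_one_line.
by rewrite lift_perm_id nth_cat size_take_a ltnn subnn.
Qed.

Definition increasing_blocks i (l : seq nat) :=
  sorted ltn (take i l) && sorted ltn (drop i l).

Lemma sorted_ltn_map_succ l : sorted ltn (map S l) = sorted ltn l.
Proof. by rewrite sorted_map; apply: eq_sorted. Qed.

Lemma sorted_ltn_zero_succ l : sorted ltn (0%N :: map S l) = sorted ltn l.
Proof. by case: l => //= m l; rewrite path_map; apply: eq_path. Qed.

Lemma sorted_ltn_inner_zero l1 l2 :
  l1 != [::] -> sorted ltn (l1 ++ 0%N :: l2) = false.
Proof.
by case: l1 => //= m l1 _; rewrite cat_path [path _ _ (_ :: _)]/= andbF.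
Qed.

Lemma is_shuffleE i j (s : 'S_(i + j)) :
  is_shuffle s = increasing_blocks i (one_line s).
Proof.
have nthE k : (k < i + j)%N -> exists2 a : 'I_(i + j),
    k = a & nth 0%N (one_line s) k = s a.
  by move=> lt_k; exists (Ordinal lt_k); rewrite // -nth_one_line.
have size1 : size (take i (one_line s)) = i.
  by rewrite size_takel ?size_one_line ?leq_addr.
have size2 : size (drop i (one_line s)) = j.
  by rewrite size_drop size_one_line addKn.
rewrite /increasing_blocks !(sorted_pairwise ltn_trans).
apply/forallP/andP => [mono_s|].
  split; apply/(pairwiseP 0%N) => b c; rewrite !inE ?size1 ?size2;
    move=> lt_b lt_c lt_bc.
    rewrite !nth_take//.
    have [|b' eq_b ->] := nthE b; first lia.
    have [|c' eq_c ->] := nthE c; first lia.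
    by apply: (implyP (forallP (mono_s b') c')); lia.
  rewrite !nth_drop.
  have [|b' eq_b ->] := nthE (i + b)%N; first lia.
  have [|c' eq_c ->] := nthE (i + c)%N; first lia.
  by apply: (implyP (forallP (mono_s b') c')); lia.
move=> [/(pairwiseP 0%N) mono1 /(pairwiseP 0%N) mono2] a.
apply/forallP => b; apply/implyP => /andP[lt_ab /orP[lt_bi|le_ia]].
  have lt_ai := ltn_trans lt_ab lt_bi.
  have := mono1 a b; rewrite !inE size1 lt_ai lt_bi !nth_take//.
  by rewrite !nth_one_line; apply.
have := mono2 (a - i)%N (b - i)%N; rewrite !inE size2 !nth_drop.
have [lt_an lt_bn le_ib] : [/\ (a < i + j)%N, (b < i + j)%N & (i <= b)%N].
  by rewrite !ltn_ord (leq_trans le_ia (ltnW lt_ab)).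
by rewrite !subnKC // !nth_one_line; apply; lia.
Qed.

Variables (F : fieldType) (T : zmodType) (V : lmodType F).
Implicit Types (G : seq T -> seq T -> V) (X : seq T).

(** The signed sum over all splittings of [X] into a subsequence of length [i]
    and the complementary one.  Indexing by [n] and [i] rather than by the two
    block lengths lets the recursion below go through without transporting
    permutations along equalities between sizes. *)
Definition unshuffle_sum n i G X : V :=
  \sum_(s : 'S_n | increasing_blocks i (one_line s))
    (-1) ^+ s *: G [seq X`_k | k <- take i (one_line s)]
                   [seq X`_k | k <- drop i (one_line s)].

Lemma unshuffle_sum0 G X : unshuffle_sum 0 0 G X = G [::] [::].
Proof.
have one_line0 (s : 'S_0) : one_line s = [::].
  by apply: size0nil; rewrite size_one_line.
rewrite /unshuffle_sum (big_pred1 1%g) => [|s].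
  by rewrite odd_perm1 expr0 scale1r one_line0.
by rewrite one_line0; apply/esym/eqP/permP; case.
Qed.

Lemma sum_perm_lift n (h : 'S_n.+1 -> V) :
  \sum_(s : 'S_n.+1) h s =
    \sum_(a < n.+1) \sum_(t : 'S_n) h (lift_perm a ord0 t).
Proof.
(* [lift_perm] is injective in position and permutation, and
   [n.+1 * n`! = n.+1`!], hence it is a bijection. *)
rewrite pair_bigA /= (reindex (fun at_ => lift_perm at_.1 ord0 at_.2)) //=.
apply/onW_bij/inj_card_bij; last first.
  by rewrite card_prod card_ord !card_Sn factS.
move=> [a t] [b u] /= eq_lift.
have eq_ab : a = b.
  apply: (@perm_inj _ (lift_perm a ord0 t)).
  by rewrite {2}eq_lift !lift_perm_id.
rewrite -eq_ab in eq_lift *; congr pair; apply/permP => k.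
apply: (@lift_inj _ ord0).
by rewrite -!(lift_perm_lift a) eq_lift.
Qed.

(** In a shuffle the smallest letter can only stand at the head of a block.
    Hence the first entry of [X] opens one of the two subsequences; opening the
    second one costs the sign of moving it past the [i] entries of the first. *)
Lemma unshuffle_sum_cons n i G x X :
  unshuffle_sum n.+1 i G (x :: X) =
    (if i is i'.+1 then unshuffle_sum n i' (fun A B => G (x :: A) B) X else 0)
    + (if (i <= n)%N then
         (-1) ^+ i *: unshuffle_sum n i (fun A B => G A (x :: B)) X else 0).
Proof.
pose term a (t : 'S_n) : V :=
  if increasing_blocks i (one_line (lift_perm a ord0 t)) then
    (-1) ^+ lift_perm a ord0 t *:
      G [seq (x :: X)`_k | k <- take i (one_line (lift_perm a ord0 t))]
        [seq (x :: X)`_k | k <- drop i (one_line (lift_perm a ord0 t))]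
  else 0.
(* The smallest letter of [lift_perm a ord0 t] stands in position [a], so the
   blocks can be increasing only if [a = i] or if [a = 0] and [0 < i]. *)
have fstE (t : 'S_n) i' : i = i'.+1 -> term ord0 t =
    if increasing_blocks i' (one_line t) then
      (-1) ^+ t *: G (x :: [seq X`_k | k <- take i' (one_line t)])
                     [seq X`_k | k <- drop i' (one_line t)]
    else 0.
  move=> eq_i; rewrite /term /increasing_blocks one_line_lift_perm.
  rewrite eq_i take0 drop0 /= -map_take -map_drop odd_lift_perm.
  by rewrite -[path _ _ _]/(sorted ltn (0%N :: _)) sorted_ltn_zero_succ
    sorted_ltn_map_succ -!map_comp.
have sndE (t : 'S_n) (a : 'I_n.+1) : a = i :> nat -> term a t =
    if increasing_blocks i (one_line t) then
      (-1) ^+ i *: ((-1) ^+ t *: G [seq X`_k | k <- take i (one_line t)]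
                     (x :: [seq X`_k | k <- drop i (one_line t)]))
    else 0.
  move=> eq_a; rewrite /term /increasing_blocks one_line_lift_perm eq_a.
  have size_take_i : size (map S (take i (one_line t))) = i.
    by rewrite size_map size_takel// size_one_line -ltnS -eq_a.
  rewrite take_size_cat ?drop_size_cat //.
  rewrite sorted_ltn_zero_succ sorted_ltn_map_succ /= -!map_comp.
  rewrite odd_lift_perm eq_a addbF signr_addb signr_odd scalerA.
  by [].
have zeroE (t : 'S_n) (a : 'I_n.+1) : a != i :> nat ->
    (0 < a)%N || (i == 0)%N -> term a t = 0.
  move=> ne_ai a_pos; rewrite /term /increasing_blocks one_line_lift_perm.
  have size_take_a : size (map S (take a (one_line t))) = a.
    by rewrite size_map size_takel// size_one_line -ltnS.
  rewrite take_cat drop_cat size_take_a; case: ltnP => [lt_ia|le_ai].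
    rewrite [X in _ && X]sorted_ltn_inner_zero ?andbF// -size_eq0.
    by rewrite size_drop size_take_a subn_eq0 -ltnNge.
  case: (i - a)%N (subn_gt0 a i) => [|m _]; first lia.
  rewrite /= sorted_ltn_inner_zero//.
  by rewrite -size_eq0 size_take_a; lia.
rewrite /unshuffle_sum big_mkcond sum_perm_lift.
rewrite (eq_bigr (fun a => \sum_t term a t)) // big_ord_recl.
have snd_sumE (a : 'I_n.+1) : a = i :> nat ->
    \sum_t term a t =
      (-1) ^+ i *: unshuffle_sum n i (fun A B => G A (x :: B)) X.
  move=> eq_a; rewrite /unshuffle_sum scaler_sumr [RHS]big_mkcond.
  by apply: eq_bigr => t _; exact: sndE.
case: (i) fstE snd_sumE zeroE => [|i'] fstE snd_sumE zeroE.
  rewrite snd_sumE // add0r big1 ?addr0// => a _.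
  by apply: big1 => t _; apply: zeroE.
congr (_ + _).
  rewrite /unshuffle_sum [RHS]big_mkcond; apply: eq_bigr => t _; exact: fstE.
have [lt_i'n|le_ni'] := ltnP i' n.
  rewrite (bigD1 (Ordinal lt_i'n)) //= snd_sumE // big1 ?addr0// => a ne_ai'.
  by apply: big1 => t _; apply: zeroE.
apply: big1 => a _; apply: big1 => t _; apply: zeroE => //.
by rewrite eqSS ltn_eqF// (leq_trans _ le_ni').
Qed.

Lemma take_one_line i j (s : 'S_(i + j)) :
  take i (one_line s) = [seq val (s (lshift j a)) | a <- enum 'I_i].
Proof.
have size_l : size (take i (one_line s)) = i.
  by rewrite size_takel ?size_one_line ?leq_addr.
apply: (@eq_from_nth _ 0%N) => [|k]; rewrite size_l.
  by rewrite size_map size_enum_ord.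
move=> lt_ki; rewrite nth_take// (nth_map (Ordinal lt_ki)) ?size_enum_ord//.
rewrite (nth_ord_enum _ (Ordinal lt_ki)).
exact: (nth_one_line s (lshift j (Ordinal lt_ki))).
Qed.

Lemma drop_one_line i j (s : 'S_(i + j)) :
  drop i (one_line s) = [seq val (s (rshift i a)) | a <- enum 'I_j].
Proof.
have size_l : size (drop i (one_line s)) = j.
  by rewrite size_drop size_one_line addKn.
apply: (@eq_from_nth _ 0%N) => [|k]; rewrite size_l.
  by rewrite size_map size_enum_ord.
move=> lt_kj; rewrite nth_drop (nth_map (Ordinal lt_kj)) ?size_enum_ord//.
rewrite (nth_ord_enum _ (Ordinal lt_kj)).
exact: (nth_one_line s (rshift i (Ordinal lt_kj))).
Qed.

Lemma shuffle_sumE i j G X :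
  \sum_(s : 'S_(i + j) | is_shuffle s) (-1) ^+ s *:
     G [seq X`_(s (lshift j a)) | a <- enum 'I_i]
       [seq X`_(s (rshift i a)) | a <- enum 'I_j] =
  unshuffle_sum (i + j) i G X.
Proof.
apply: eq_big => [s|s _]; first exact: is_shuffleE.
by rewrite take_one_line drop_one_line -!map_comp.
Qed.
End Unshuffle.

(** * Composition of cochains by recursion *)

Section Insertion.
Variables (F : fieldType) (L : vectType F).
Implicit Types (f Q R : precochain L) (U : L * L) (X : seq (L * L)) (z : L).

(** The interior product of a cochain with [U], seen as a decomposable element
    of the exterior square. *)
Definition contract U f : precochain L := fun X => f (U :: X).

(** The composition [circ p q f Q] by recursion on the sequence of pairs.  The
    first pair [U] is an argument of [f] standing before [Q], or the first
    argument of [Q], or (when [Q] has consumed all its pairs) the pair on which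
    [Q] acts.  So contraction with [U] is a graded derivation of the
    composition, up to the last term, and the sign [(-1) ^+ q] is what remains
    of the sign of the shuffles. *)
Fixpoint insertion q f Q X z {struct X} : L :=
  if X is U :: X' then
    (-1) ^+ q *: insertion q (contract U f) Q X' z
    + (if q is q'.+1 then insertion q' f (contract U Q) X' z
       else f ((Q [::] U.1, U.2) :: X') z + f ((U.1, Q [::] U.2) :: X') z)
  else if q is 0 then f [::] (Q [::] z) else 0.

Lemma insertion_short q f Q X z : (size X < q)%N -> insertion q f Q X z = 0.
Proof.
elim: X q f Q => [|U X IH] [|q] f Q //= lt_Xq.
by rewrite !IH ?scaler0 ?addr0 // ltnW.
Qed.

(** The terms of [circ] in which [Q] acts on the pair in position [k + q]. *)
Definition slot_sum k q f Q X z : L :=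
  unshuffle_sum (k + q) k (fun A B =>
    f (A ++ (Q B (X`_(k + q)).1, (X`_(k + q)).2) :: drop (k + q).+1 X) z
    + f (A ++ ((X`_(k + q)).1, Q B (X`_(k + q)).2) :: drop (k + q).+1 X) z) X.

(** The terms of [circ] in which [Q] acts on the last argument. *)
Definition last_sum p q f Q X z : L :=
  unshuffle_sum (p + q) p (fun A B => f A (Q B z)) X.

Lemma slot_sum00 f Q U X z :
  slot_sum 0 0 f Q (U :: X) z =
    f ((Q [::] U.1, U.2) :: X) z + f ((U.1, Q [::] U.2) :: X) z.
Proof. by rewrite /slot_sum /= add0n unshuffle_sum0 /= drop0. Qed.

Lemma slot_sum_cons k q f Q U X z : (0 < k + q)%N ->
  slot_sum k q f Q (U :: X) z =
    (if k is k'.+1 then slot_sum k' q (contract U f) Q X z else 0)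
    + (if q is q'.+1 then (-1) ^+ k *: slot_sum k q' f (contract U Q) X z
       else 0).
Proof.
rewrite /slot_sum; case: q => [|q] k_pos.
  case: k k_pos => // k _.
  by rewrite addSn unshuffle_sum_cons addn0 ltnn.
rewrite addnS unshuffle_sum_cons leq_addr.
by case: k {k_pos} => [|k] //; rewrite addSnnS.
Qed.

Lemma last_sum_cons p q f Q U X z : (0 < p + q)%N ->
  last_sum p q f Q (U :: X) z =
    (if p is p'.+1 then last_sum p' q (contract U f) Q X z else 0)
    + (if q is q'.+1 then (-1) ^+ p *: last_sum p q' f (contract U Q) X z
       else 0).
Proof.
rewrite /last_sum; case: q => [|q] p_pos.
  case: p p_pos => // p _.
  by rewrite addSn unshuffle_sum_cons addn0 ltnn.
rewrite addnS unshuffle_sum_cons leq_addr.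
by case: p {p_pos} => [|p] //; rewrite addSnnS.
Qed.

Lemma circE p q f Q X z : size X = (p + q)%N ->
  circ p q f Q X z =
    \sum_(k < p) (-1) ^+ (k * q) *: slot_sum k q f Q X z
    + (-1) ^+ (p * q) *: last_sum p q f Q X z.
Proof.
move=> size_X; rewrite /circ size_X eqxx /= -big_split /= -scaler_sumr.
congr (_ + _ *: _).
  apply: eq_bigr => k _; rewrite -scalerDr -big_split /=; congr (_ *: _).
  rewrite /slot_sum -shuffle_sumE; apply: eq_bigr => s _.
  by rewrite -scalerDr.
by rewrite /last_sum -shuffle_sumE.
Qed.

(** Peeling off the first pair, the shuffle recursion multiplies the term of
    index [k] by [(-1) ^+ k] whenever the pair goes to [Q], which turns
    [(-1) ^+ (k * q.+1)] into [(-1) ^+ (k * q)]; when it goes to [f], the index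
    drops to [k - 1] and the sign [(-1) ^+ q.+1] comes out of the sum. *)
Lemma circ_insertion p q f Q X z : size X = (p + q)%N ->
  circ p q f Q X z = insertion q f Q X z.
Proof.
move=> size_X; rewrite circE//.
elim: X p q f Q size_X => [|U X IH] p q f Q.
  case: p q => [|p] [|q] //= _.
  by rewrite big_ord0 add0r scale1r /last_sum unshuffle_sum0.
case: q => [|q] /= size_X.
  case: p size_X => // p [size_X].
  rewrite scale1r -(IH p 0)// big_ord_recl slot_sum00 scale1r last_sum_cons//.
  rewrite !muln0 !addr0 scale1r -[LHS]addrA [LHS]addrC.
  congr (_ + _ + _); apply: eq_bigr => k _.
  by rewrite slot_sum_cons// addr0 !muln0.
have size_X2 : size X = (p + q)%N by apply: succn_inj; rewrite size_X addnS.
rewrite -(IH _ _ f _ size_X2) last_sum_cons ?addnS//.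
have snd_sign k : (-1 : F) ^+ (k * q.+1) * (-1) ^+ k = (-1) ^+ (k * q).
  by rewrite mulnS addnC exprD -mulrA -expr2 sqrr_sign mulr1.
rewrite scalerDr scalerA snd_sign.
rewrite (eq_bigr (fun k : 'I_p => (-1) ^+ (k * q.+1) *:
    (if val k is k'.+1 then slot_sum k' q.+1 (contract U f) Q X z else 0)
    + (-1) ^+ (k * q) *: slot_sum k q f (contract U Q) X z)); last first.
  by move=> k _; rewrite slot_sum_cons ?addnS// scalerDr scalerA snd_sign.
rewrite big_split /= addrACA; congr (_ + _).
case: p size_X {size_X2} => [|p] size_X.
  by rewrite big_ord0 insertion_short ?scaler0 ?addr0//; move: size_X => [->].
have [size_X1] := size_X; rewrite -(IH p q.+1)//.
have fst_sign k :
    (-1 : F) ^+ (k.+1 * q.+1) = (-1) ^+ q.+1 * (-1) ^+ (k * q.+1).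
  by rewrite mulSn exprD.
rewrite big_ord_recl /= scaler0 add0r fst_sign -scalerA scalerDr.
congr (_ + _); rewrite [RHS]scaler_sumr; apply: eq_bigr => k _.
by rewrite fst_sign -scalerA.
Qed.

End Insertion.

(** * Pointwise and coordinatewise computations *)

Section Evaluation.
Variables (F : fieldType) (L : vectType F).
Implicit Types (f g : precochain L) (X : seq (L * L)) (x y z : L).

Lemma precochainD f g X z : (f + g) X z = f X z + g X z. Proof. by []. Qed.
Lemma precochainN f X z : (- f) X z = - f X z. Proof. by []. Qed.
Lemma precochainZ a f X z : (a *: f) X z = a *: f X z. Proof. by []. Qed.
Lemma precochain0 X z : (0 : precochain L) X z = 0. Proof. by []. Qed.
Definition precochainE := (precochainD, precochainN, precochainZ, precochain0).

Lemma eq_coordinates (x y : L) :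
  (forall i, coord (vbasis fullv) i x = coord (vbasis fullv) i y) -> x = y.
Proof.
move=> eq_xy; rewrite (coord_vbasis (memvf x)) (coord_vbasis (memvf y)).
by apply: eq_bigr => i _; rewrite eq_xy.
Qed.

Lemma sign_mul_self k : (-1 : F) ^+ k * (-1) ^+ k = 1.
Proof. by rewrite -expr2 sqrr_sign. Qed.

End Evaluation.

(* Identities between vectors are passed to the ring decision procedure one
   coordinate at a time. *)
Ltac to_coordinates := apply: eq_coordinates => ?;
  rewrite ?(linearD, linearN, linearZ, linear0) /=.
Ltac vector_ring := to_coordinates; ring.

(** * Multilinearity and skew-symmetry of compositions *)

Section InsertionCochain.
Variables (F : fieldType) (L : vectType F).
Implicit Types (f g Q R : precochain L) (U : L * L) (X : seq (L * L)).
Implicit Types (x y z : L).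

Lemma contract_cochain n f U : cochain n f -> cochain n.-1 (contract U f).
Proof.
case=> f_size f_ll f_lr f_last f_skew f_skewl; split.
- by move=> X z; case: n f_size => [|n] f_size size_X; apply: f_size.
- by move=> X1; apply: (f_ll (U :: X1)).
- by move=> X1; apply: (f_lr (U :: X1)).
- by move=> X; apply: f_last.
- by move=> X1; apply: (f_skew (U :: X1)).
by move=> X; apply: (f_skewl (U :: X)).
Qed.

Lemma cochain0P f : cochain 0 f -> f = 0.
Proof.
move=> f_co; apply/funext=> X; apply/funext => z; exact: (cochain_size f_co).
Qed.

Lemma cochain_zero n : cochain n (0 : precochain L).
Proof.
split => *; rewrite /GRing.zero /= ?oppr0// => a u v.
all: by rewrite scaler0 addr0.
Qed.

Lemma contract_linear_l n f a x x' y : cochain n f ->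
  contract (a *: x + x', y) f = a *: contract (x, y) f + contract (x', y) f.
Proof.
move=> f_co; apply/funext => X; apply/funext => z.
exact: (cochain_linear_l f_co [::]).
Qed.

Lemma contract_linear_r n f a x y y' : cochain n f ->
  contract (x, a *: y + y') f = a *: contract (x, y) f + contract (x, y') f.
Proof.
move=> f_co; apply/funext => X; apply/funext => z.
exact: (cochain_linear_r f_co [::]).
Qed.

Lemma contract_skew n f x y : cochain n f ->
  contract (y, x) f = - contract (x, y) f.
Proof.
move=> f_co; apply/funext => X; apply/funext => z.
exact: (cochain_skew f_co [::]).
Qed.

Lemma insertion_linear_l q a f g Q X z :
  insertion q (a *: f + g) Q X z
    = a *: insertion q f Q X z + insertion q g Q X z.
Proof.
elim: X q f g Q => [|U X IH] [|q] f g Q //=; rewrite ?scaler0 ?addr0//.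
- rewrite -[contract U (_ + _)]/(a *: contract U f + contract U g) IH.
  by rewrite ?precochainE; vector_ring.
- rewrite -[contract U (_ + _)]/(a *: contract U f + contract U g) !IH.
  by rewrite ?precochainE; vector_ring.
Qed.

Lemma insertionDl q f g Q X z :
  insertion q (f + g) Q X z = insertion q f Q X z + insertion q g Q X z.
Proof. by rewrite -[f in LHS]scale1r insertion_linear_l scale1r. Qed.

Lemma insertion0l q Q X z : insertion q 0 Q X z = 0.
Proof.
elim: X q Q => [|U X IH] [|q] Q //=; last by rewrite !IH scaler0 addr0.
by rewrite IH scaler0 !precochain0 !addr0.
Qed.

Lemma insertionNl q f Q X z : insertion q (- f) Q X z = - insertion q f Q X z.
Proof.
have := insertion_linear_l q (-1) f 0 Q X z.
by rewrite !scaleN1r addr0 insertion0l addr0.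
Qed.

Lemma insertion_linear_r n q f a Q R X z : cochain n f ->
  insertion q f (a *: Q + R) X z
    = a *: insertion q f Q X z + insertion q f R X z.
Proof.
elim: X n q f Q R => [|U X IH] n [|q] f Q R f_co //=.
- by rewrite !precochainE (cochain_linear_last f_co).
- by rewrite scaler0 addr0.
- rewrite (IH n.-1); last exact: contract_cochain.
  rewrite !precochainE.
  rewrite (cochain_linear_l f_co [::]) (cochain_linear_r f_co [::]).
  by vector_ring.
rewrite (IH n.-1); last exact: contract_cochain.
rewrite -[contract U (_ + _)]/(a *: contract U Q + contract U R) (IH n)//.
by vector_ring.
Qed.

Lemma insertionDr n q f Q R X z : cochain n f ->
  insertion q f (Q + R) X z = insertion q f Q X z + insertion q f R X z.
Proof.
move=> f_co; rewrite -[Q in LHS]scale1r.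
by rewrite (insertion_linear_r _ _ _ _ _ _ f_co) scale1r.
Qed.

Lemma insertion0r n q f X z : cochain n f -> insertion q f 0 X z = 0.
Proof.
move=> f_co; have := insertion_linear_r q (-1) 0 0 X z f_co.
by rewrite scaleN1r addr0 oppr0 scaleN1r addNr.
Qed.

Lemma insertionNr n q f Q X z : cochain n f ->
  insertion q f (- Q) X z = - insertion q f Q X z.
Proof.
move=> f_co; have := insertion_linear_r q (-1) Q 0 X z f_co.
by rewrite !scaleN1r addr0 (insertion0r _ _ _ f_co) addr0.
Qed.

(** All conditions concern entries at a fixed position, so they pass through the
    recursion until that position comes first.  The skew-symmetry in the last
    three arguments has two sources: when [Q] has no pair left, [Q] acts as a
    derivation on these three arguments of [f], and when [Q] has one pair left,
    they are the last three arguments of [Q]. *)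
Lemma insertion_cochain n q f Q :
  cochain n f -> cochain q.+1 Q -> cochain (n + q) (insertion q f Q).
Proof.
case: n => [/cochain0P-> _|n].
  rewrite (_ : insertion q 0 Q = 0); first exact: cochain_zero.
  by apply/funext => X; apply/funext => z; apply: insertion0l.
move=> f_co Q_co; split.
- move=> X z; elim: X n q f Q f_co Q_co => [|U X IH] n q f Q f_co Q_co /=.
    by case: q Q_co => // _; rewrite addn0 => ?; apply: (cochain_size f_co).
  move=> size_X.
  have ->: insertion q (contract U f) Q X z = 0.
    case: n f_co size_X => [|n] f_co size_X; last first.
      by apply: (IH n); [exact: (contract_cochain U f_co)| |lia].
    by rewrite (_ : contract U f = 0) ?insertion0l//; apply/funext => X';
      apply/funext => z'; apply: (cochain_size f_co).
  rewrite scaler0 add0r; case: q Q_co size_X => [|q] Q_co size_X.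
    by rewrite !(cochain_size f_co) ?addr0//=; lia.
  by apply: (IH n) => //; [exact: (contract_cochain U Q_co)|lia].
- move=> X1 X2 y z a x x'.
  elim: X1 q n.+1 f Q f_co Q_co => [|U X1 IH] q m f Q f_co Q_co /=.
    rewrite (contract_linear_l _ _ _ _ f_co) insertion_linear_l.
    case: q Q_co => [|q] Q_co.
      rewrite (cochain_linear_last Q_co).
      rewrite !(cochain_linear_l f_co [::]).
      by vector_ring.
    rewrite (contract_linear_l _ _ _ _ Q_co).
    rewrite (insertion_linear_r _ _ _ _ _ _ f_co).
    by vector_ring.
  rewrite (IH _ m.-1)//; last exact: contract_cochain.
  case: q Q_co => [|q] Q_co.
    rewrite (cochain_linear_l f_co (_ :: _)) (cochain_linear_l f_co (_ :: _)).
    by vector_ring.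
  rewrite (IH _ m)//; last exact: (contract_cochain U Q_co).
  by vector_ring.
- move=> X1 X2 x z a y y'.
  elim: X1 q n.+1 f Q f_co Q_co => [|U X1 IH] q m f Q f_co Q_co /=.
    rewrite (contract_linear_r _ _ _ _ f_co) insertion_linear_l.
    case: q Q_co => [|q] Q_co.
      rewrite (cochain_linear_last Q_co).
      rewrite !(cochain_linear_r f_co [::]).
      by vector_ring.
    rewrite (contract_linear_r _ _ _ _ Q_co).
    rewrite (insertion_linear_r _ _ _ _ _ _ f_co).
    by vector_ring.
  rewrite (IH _ m.-1)//; last exact: contract_cochain.
  case: q Q_co => [|q] Q_co.
    rewrite (cochain_linear_r f_co (_ :: _)) (cochain_linear_r f_co (_ :: _)).
    by vector_ring.
  rewrite (IH _ m)//; last exact: (contract_cochain U Q_co).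
  by vector_ring.
- move=> X a z z'.
  elim: X q n.+1 f Q f_co Q_co => [|U X IH] q m f Q f_co Q_co /=.
    case: q Q_co => [|q] Q_co; last by rewrite scaler0 addr0.
    by rewrite (cochain_linear_last Q_co) (cochain_linear_last f_co).
  rewrite (IH _ m.-1)//; last exact: contract_cochain.
  case: q Q_co => [|q] Q_co.
    by rewrite !(cochain_linear_last f_co); vector_ring.
  rewrite (IH _ m)//; last exact: (contract_cochain U Q_co).
  by vector_ring.
- move=> X1 X2 x y z.
  elim: X1 q n.+1 f Q f_co Q_co => [|U X1 IH] q m f Q f_co Q_co /=.
    rewrite (contract_skew _ _ f_co) insertionNl.
    case: q Q_co => [|q] Q_co.
      rewrite (cochain_skew f_co [::] _ x (Q [::] y)).
      rewrite (cochain_skew f_co [::] _ (Q [::] x) y) /=.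
      by vector_ring.
    rewrite (contract_skew _ _ Q_co) (insertionNr _ _ _ _ f_co).
    by vector_ring.
  rewrite (IH _ m.-1)//; last exact: contract_cochain.
  case: q Q_co => [|q] Q_co.
    rewrite !(cochain_skew f_co (_ :: X1) X2 x y).
    by vector_ring.
  rewrite (IH _ m)//; last exact: (contract_cochain U Q_co).
  by vector_ring.
move=> X x y z.
elim: X q n.+1 f Q f_co Q_co => [|U X IH] q m f Q f_co Q_co /=.
  case: q Q_co => [|[|q]] Q_co /=; last by rewrite !scaler0 addr0 oppr0.
    rewrite /contract (cochain_skew_last f_co [::] x y).
    rewrite (cochain_skew_last f_co [::] x (Q [::] y)).
    rewrite (cochain_skew_last f_co [::] (Q [::] x) y) /=.
    by vector_ring.
  rewrite /contract (cochain_skew_last Q_co [::] x y) /=.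
  rewrite !scaler0 !add0r.
  have f_linear u v := cochain_linear_last f_co [::] (-1) u v.
  have f0 : f [::] 0 = 0.
    by have := f_linear 0 0; rewrite !scaleN1r oppr0 addr0 addNr.
  by rewrite -[- Q _ _]addr0 -scaleN1r f_linear f0 addr0 scaleN1r.
rewrite (IH _ m.-1)//; last exact: contract_cochain.
case: q Q_co => [|q] Q_co.
  rewrite !(cochain_skew_last f_co (_ :: X) x y z).
  by vector_ring.
rewrite (IH _ m)//; last exact: (contract_cochain U Q_co).
by vector_ring.
Qed.

End InsertionCochain.

(** * The pre-Lie identity *)

Section PreLie.
Variables (F : fieldType) (L : vectType F).
Implicit Types (f Q R : precochain L) (U : L * L) (X : seq (L * L)).

Lemma contract_insertionS q f Q U :
  contract U (insertion q.+1 f Q) =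
    (-1) ^+ q.+1 *: (insertion q.+1 (contract U f) Q : precochain L)
    + insertion q f (contract U Q).
Proof. by []. Qed.

Lemma contract_insertion0 f Q U :
  contract U (insertion 0 f Q) =
    (insertion 0 (contract U f) Q : precochain L)
    + (contract (Q [::] U.1, U.2) f + contract (U.1, Q [::] U.2) f).
Proof. by rewrite -[X in X + _]scale1r. Qed.

Lemma insertion_zero q Q : insertion q 0 Q = 0 :> precochain L.
Proof. by apply/funext => X; apply/funext => z; apply: insertion0l. Qed.

Lemma contract_cochain1 Q U : cochain 1 Q -> contract U Q = 0.
Proof. by move=> Q_co; apply: cochain0P; apply: (contract_cochain U Q_co). Qed.

Definition associator q r f Q R X z : L :=
  insertion r (insertion q f Q) R X z
  - insertion (q + r) f (insertion r Q R) X z.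

(** The graded pre-Lie identity.  Contraction being a graded derivation of the
    insertion, the contraction of an associator is a signed sum of associators
    with one contracted entry, to which the induction hypothesis applies.  When
    [Q] or [R] is a linear map of [L], it may also act on the first pair [U].
    The terms where only one of them does so occur on both sides.  If both do,
    their action on the same component of [U] is cancelled by the insertion of
    one into the other, and their action on different components is symmetric
    in [Q] and [R]. *)
Lemma associator_symmetric n q r f Q R X z :
  cochain n f -> cochain q.+1 Q -> cochain r.+1 R ->
  associator q r f Q R X z = (-1) ^+ (q * r) *: associator r q f R Q X z.
Proof.
rewrite /associator.
elim: X n q r f Q R => [|U X IH] n q r f Q R f_co Q_co R_co.
  case: q Q_co => [|q] Q_co; case: r R_co => [|r] R_co /=;
    rewrite ?subrr ?subr0 ?scaler0 //.
have fU_co := contract_cochain U f_co.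
have := IH _ q r _ Q R fU_co Q_co R_co.
case: q Q_co => [|q] Q_co; case: r R_co => [|r] R_co; rewrite /=.
- rewrite !contract_insertion0 !insertionDl => /(canRL (subrK _)) ->.
  by vector_ring.
- have RU_co := contract_cochain U R_co.
  have := IH _ 0%N r _ Q _ f_co Q_co RU_co.
  rewrite !contract_insertionS !contract_insertion0 (contract_cochain1 _ Q_co).
  rewrite insertion_zero scaler0 !add0r !add0n !addn0 !mul0n !expr0 !scale1r.
  rewrite !(insertion_linear_l, insertionDl, insertionDr _ _ _ _ _ f_co).
  move=> /(canRL (subrK _)) -> /(canRL (subrK _)) ->.
  by vector_ring.
- have QU_co := contract_cochain U Q_co.
  have := IH _ q 0%N _ _ R f_co QU_co R_co.
  rewrite !contract_insertionS !contract_insertion0 (contract_cochain1 _ R_co).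
  rewrite insertion_zero scaler0 !add0r !add0n !addn0 !muln0 !expr0 !scale1r.
  rewrite !(insertion_linear_l, insertionDl, insertionDr _ _ _ _ _ f_co).
  move=> /(canRL (subrK _)) -> /(canRL (subrK _)) ->.
  by vector_ring.
(* The three induction hypotheses are solved for the associators on the left
   and substituted; only identities between signs remain. *)
have QU_co := contract_cochain U Q_co.
have RU_co := contract_cochain U R_co.
have := IH _ q r.+1 _ _ R f_co QU_co R_co.
have := IH _ q.+1 r _ Q _ f_co Q_co RU_co.
rewrite !contract_insertionS.
rewrite !(insertion_linear_l, insertion_linear_r _ _ _ _ _ _ f_co) /=.
rewrite !(addSn, addnS) (addnC r q) (mulSn, mulnS).
move=> /(canRL (subrK _)) -> /(canRL (subrK _)) -> /(canRL (subrK _)) ->.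
rewrite !(mulSn, mulnS, exprS, exprD).
move: (sign_mul_self F q) (sign_mul_self F r) (sign_mul_self F (q * r)).
move: ((-1) ^+ q) ((-1) ^+ r) ((-1) ^+ (q * r)) => a b c a2 b2 c2.
by to_coordinates; ring: a2 b2 c2.
Qed.
End PreLie.

(** * The Jacobi identity for the commutator *)

Section ThreeLie.
Variables (F : fieldType) (L : vectType F).
Implicit Types (f g P Q R : precochain L) (X : seq (L * L)) (z : L).

Lemma cochainD n a P Q : cochain n P -> cochain n Q -> cochain n (a *: P + Q).
Proof.
move=> P_co Q_co; split.
- move=> X z size_X; rewrite !precochainE.
  by rewrite !(cochain_size P_co, cochain_size Q_co) // scaler0 addr0.
- move=> X1 X2 y z b x x'; rewrite !precochainE.
  by rewrite (cochain_linear_l P_co) (cochain_linear_l Q_co); vector_ring.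
- move=> X1 X2 y z b x x'; rewrite !precochainE.
  by rewrite (cochain_linear_r P_co) (cochain_linear_r Q_co); vector_ring.
- move=> X b x x'; rewrite !precochainE.
  by rewrite (cochain_linear_last P_co) (cochain_linear_last Q_co); vector_ring.
- move=> X1 X2 x y z; rewrite !precochainE.
  by rewrite (cochain_skew P_co) (cochain_skew Q_co); vector_ring.
move=> X x y z; rewrite !precochainE.
by rewrite (cochain_skew_last P_co) (cochain_skew_last Q_co); vector_ring.
Qed.

Definition insertion_bracket p q P Q : precochain L :=
  insertion q P Q - (-1) ^+ (p * q) *: (insertion p Q P : precochain L).

Lemma insertion_bracket_cochain p q P Q : cochain p.+1 P -> cochain q.+1 Q ->
  cochain (p + q).+1 (insertion_bracket p q P Q).
Proof.
move=> P_co Q_co; rewrite /insertion_bracket addrC -scaleNr.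
apply: cochainD; last by rewrite -addSn; exact: insertion_cochain.
by rewrite addnC -addSn; apply: insertion_cochain.
Qed.

Lemma circ_cochain p q P Q : cochain p.+1 P -> cochain q.+1 Q ->
  circ p q P Q = insertion q P Q.
Proof.
move=> P_co Q_co; apply/funext => X; apply/funext => z.
have [size_X|size_X] := eqVneq (size X) (p + q)%N; first exact: circ_insertion.
by rewrite /circ size_X (cochain_size (insertion_cochain P_co Q_co)).
Qed.

Lemma three_Lie_bracketE p q P Q : cochain p.+1 P -> cochain q.+1 Q ->
  three_Lie_bracket p.+1 q.+1 P Q = insertion_bracket p q P Q.
Proof.
by move=> P_co Q_co; rewrite /three_Lie_bracket !subn1 /= !circ_cochain.
Qed.

Lemma insertion_subl q a f g Q X z :
  insertion q (f - a *: g) Q X z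
    = insertion q f Q X z - a *: insertion q g Q X z.
Proof. by rewrite addrC -scaleNr insertion_linear_l addrC scaleNr. Qed.

Lemma insertion_subr n q a f Q R X z : cochain n f ->
  insertion q f (Q - a *: R) X z
    = insertion q f Q X z - a *: insertion q f R X z.
Proof.
move=> f_co; rewrite addrC -scaleNr.
by rewrite (insertion_linear_r _ _ _ _ _ _ f_co) addrC scaleNr.
Qed.

(** The graded commutator of a graded pre-Lie product satisfies the graded
    Jacobi identity: by the three instances of [associator_symmetric] the twelve
    double products cancel. *)
Lemma insertion_bracket_Jacobi p q r P Q R :
  cochain p.+1 P -> cochain q.+1 Q -> cochain r.+1 R ->
  insertion_bracket p (q + r) P (insertion_bracket q r Q R) =
    insertion_bracket (p + q) r (insertion_bracket p q P Q) R
    + (-1) ^+ (p * q) *: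
        insertion_bracket q (p + r) Q (insertion_bracket p r P R).
Proof.
move=> P_co Q_co R_co; apply/funext => X; apply/funext => z.
rewrite /insertion_bracket !precochainE.
rewrite !(insertion_subl, insertion_subr _ _ _ _ _ _ P_co,
  insertion_subr _ _ _ _ _ _ Q_co, insertion_subr _ _ _ _ _ _ R_co).
have := associator_symmetric X z P_co Q_co R_co.
have := associator_symmetric X z Q_co P_co R_co.
have := associator_symmetric X z R_co P_co Q_co.
rewrite /associator.
move=> /(canRL (subrK _)) -> /(canRL (subrK _)) -> /(canRL (subrK _)) ->.
rewrite !(mulnDl, mulnDr) ?(mulnC q p) ?(mulnC r p) ?(mulnC r q).
rewrite ?(addnC r p) ?(addnC r q) ?(addnC q p) !exprD.
move: (sign_mul_self F (p * q)) (sign_mul_self F (p * r)).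
move: (sign_mul_self F (q * r)).
move: ((-1) ^+ (p * q)) ((-1) ^+ (p * r)) ((-1) ^+ (q * r)) => a b c c2 a2 b2.
by to_coordinates; ring: a2 b2 c2.
Qed.

End ThreeLie.

(** * The bracket on pairs of cochains *)

Section AllArities.
Variables (F : fieldType) (L : vectType F).
Implicit Types (f g P Q R : precochain L) (X : seq (L * L)) (z : L).

(** The zero cochains of arity [0] may be counted as cochains of arity [1]: this
    is what the truncated subtraction in the bracket makes of them. *)
Lemma cochain_pos m P : cochain m P -> cochain (m - 1).+1 P.
Proof.
case: m => [/cochain0P->|m]; first exact: cochain_zero.
by rewrite subn1.
Qed.

Lemma three_Lie_bracket_insertion m n P Q : cochain m P -> cochain n Q ->
  three_Lie_bracket m n P Q = insertion_bracket (m - 1)%N (n - 1)%N P Q.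
Proof.
move=> /cochain_pos P_co /cochain_pos Q_co.
by rewrite /three_Lie_bracket !circ_cochain.
Qed.

Lemma three_Lie_bracket_skew m n P Q :
  three_Lie_bracket m n P Q =
    - ((-1) ^+ ((m - 1) * (n - 1)) *: three_Lie_bracket n m Q P).
Proof.
rewrite /three_Lie_bracket scalerBr scalerA (mulnC (n - 1)%N) -expr2 sqrr_sign.
by rewrite scale1r opprB.
Qed.

Lemma three_Lie_bracket_linear_l m n a P P' Q :
  cochain m P -> cochain m P' -> cochain n Q ->
  three_Lie_bracket m n (a *: P + P') Q =
    a *: three_Lie_bracket m n P Q + three_Lie_bracket m n P' Q.
Proof.
move=> P_co P'_co Q_co.
rewrite !three_Lie_bracket_insertion//; last exact: cochainD.
apply/funext => X; apply/funext => z; rewrite /insertion_bracket !precochainE.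
rewrite insertion_linear_l (insertion_linear_r _ _ _ _ _ _ Q_co).
by vector_ring.
Qed.

Lemma three_Lie_bracket_linear_r m n a P Q Q' :
  cochain m P -> cochain n Q -> cochain n Q' ->
  three_Lie_bracket m n P (a *: Q + Q') =
    a *: three_Lie_bracket m n P Q + three_Lie_bracket m n P Q'.
Proof.
move=> P_co Q_co Q'_co.
rewrite three_Lie_bracket_skew three_Lie_bracket_linear_l//.
rewrite (three_Lie_bracket_skew m n P Q) (three_Lie_bracket_skew m n P Q').
by rewrite scalerDr opprD scalerN !scalerA mulrC.
Qed.

Lemma three_Lie_bracket0l m n Q : cochain n Q -> three_Lie_bracket m n 0 Q = 0.
Proof.
move=> Q_co; have O_co := cochain_zero L m.
have := three_Lie_bracket_linear_l (-1) O_co O_co Q_co.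
by rewrite scaleN1r addr0 oppr0 scaleN1r addNr.
Qed.

Lemma three_Lie_bracket0r m n P : cochain m P -> three_Lie_bracket m n P 0 = 0.
Proof.
move=> P_co.
by rewrite three_Lie_bracket_skew three_Lie_bracket0l// scaler0 oppr0.
Qed.

Lemma three_Lie_bracket_cochain m n P Q : cochain m P -> cochain n Q ->
  cochain (m + n - 1) (three_Lie_bracket m n P Q).
Proof.
move=> P_co Q_co; case: m P_co => [/cochain0P->|m P_co].
  by rewrite three_Lie_bracket0l//; apply: cochain_zero.
case: n Q_co => [/cochain0P->|n Q_co].
  by rewrite three_Lie_bracket0r//; apply: cochain_zero.
rewrite three_Lie_bracketE// addSn subn1 addnS.
exact: insertion_bracket_cochain.
Qed.

Lemma three_Lie_bracket_Jacobi m n k P Q R :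
  cochain m P -> cochain n Q -> cochain k R ->
  three_Lie_bracket m (n + k - 1) P (three_Lie_bracket n k Q R) =
    three_Lie_bracket (m + n - 1) k (three_Lie_bracket m n P Q) R
    + (-1) ^+ ((m - 1) * (n - 1)) *:
        three_Lie_bracket n (m + k - 1) Q (three_Lie_bracket m k P R).
Proof.
move=> P_co Q_co R_co.
have PQ_co := three_Lie_bracket_cochain P_co Q_co.
have PR_co := three_Lie_bracket_cochain P_co R_co.
have QR_co := three_Lie_bracket_cochain Q_co R_co.
case: m P_co PQ_co PR_co => [|m] P_co PQ_co PR_co.
  rewrite (cochain0P P_co) !three_Lie_bracket0l// ?three_Lie_bracket0r//.
  by rewrite scaler0 addr0.
case: n Q_co PQ_co QR_co => [|n] Q_co PQ_co QR_co.
  rewrite (cochain0P Q_co) !(three_Lie_bracket0l, three_Lie_bracket0r)//.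
  by rewrite scaler0 addr0.
case: k R_co PR_co QR_co => [|k] R_co PR_co QR_co.
  rewrite (cochain0P R_co) !three_Lie_bracket0r// scaler0 addr0//.
move: PQ_co PR_co QR_co; rewrite !addSn !addnS !subn1 /=.
rewrite !three_Lie_bracketE//.
- by move=> *; exact: insertion_bracket_Jacobi.
all: exact: insertion_bracket_cochain.
Qed.

(** Components of arity [0] vanish, so a sign with the truncated exponent
    [q.-1] may be computed as if [q] were positive. *)
Lemma sign_pred (V : lmodType F) p q (v : V) : (q = 0%N -> v = 0) ->
  (-1) ^+ (p * q.-1) *: v = (-1) ^+ (p * q + p) *: v.
Proof.
case: q => [v0|q _]; first by rewrite v0 ?scaler0.
have -> : (p * q.+1 + p = p * q.+1.-1 + (p + p))%N.
  by rewrite mulnS [LHS]addnC addnA [LHS]addnC.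
by rewrite exprD -[(-1) ^+ (p + p)]signr_odd oddD addbb mulr1.
Qed.

(** A pair [(P, P')] is [P + e P'] for a formal parameter [e] of degree 1 with
    [e ^+ 2 = 0], so that the bracket is the extension of the bracket of
    cochains to [e]; the second components of the axioms are then the axioms
    for cochains in which exactly one entry is a primed one. *)
Theorem LieDer_graded_Lie :
  graded_Lie_bracket (@LieDer_cochain F L) (@LieDer_bracket F L).
Proof.
split.
- move=> p _; split; first by split; apply: cochain_zero.
  by move=> a u v [u1 u2] [v1 v2]; split; apply: cochainD.
- case=> [|p] // [|q] // [P P'] [Q Q'] _ _ [P_co P'_co] [Q_co Q'_co].
  rewrite /= in P_co P'_co Q_co Q'_co.
  split; first exact: three_Lie_bracket_cochain.
  move: P'_co Q'_co; rewrite /LieDer_bracket /= !subn1 !addSn /= addnS.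
  move=> P'_co Q'_co.
  have := three_Lie_bracket_cochain P_co Q'_co.
  have := three_Lie_bracket_cochain P'_co Q_co.
  rewrite addSn addnS !subn1 /= => ? ?; exact: cochainD.
- move=> p q a [P P'] [P2 P2'] [Q Q'] _ _.
  move=> [P_co P'_co] [P2_co P2'_co] [Q_co Q'_co].
  rewrite /= in P_co P'_co P2_co P2'_co Q_co Q'_co.
  congr pair; rewrite /= ?three_Lie_bracket_linear_l//.
  apply/funext => X; apply/funext => z; rewrite !precochainE.
  by vector_ring.
- move=> p q a [P P'] [Q Q'] [Q2 Q2'] _ _.
  move=> [P_co P'_co] [Q_co Q'_co] [Q2_co Q2'_co].
  rewrite /= in P_co P'_co Q2_co Q2'_co Q_co Q'_co.
  congr pair; rewrite /= ?three_Lie_bracket_linear_r//.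
  apply/funext => X; apply/funext => z; rewrite !precochainE.
  by vector_ring.
- case=> [|p] // [|q] // [P P'] [Q Q'] _ _ [P_co P'_co] [Q_co Q'_co].
  rewrite /= in P_co P'_co Q_co Q'_co.
  congr pair; rewrite /=; first exact: three_Lie_bracket_skew.
  rewrite !subn1 /= in P'_co Q'_co *.
  rewrite (three_Lie_bracket_skew p.+1) (three_Lie_bracket_skew _ q.+1).
  rewrite !subn1 /= (mulnC p.-1).
  rewrite sign_pred => [|q0]; last first.
    by rewrite q0 in Q'_co *; rewrite (cochain0P Q'_co) three_Lie_bracket0l.
  rewrite sign_pred => [|p0]; last first.
    by rewrite p0 in P'_co *; rewrite (cochain0P P'_co) three_Lie_bracket0r.
  apply/funext => X; apply/funext => z; rewrite !precochainE.
  rewrite !(addn1, exprS, exprD) (mulnC q p).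
  move: (sign_mul_self F p) (sign_mul_self F q).
  move: ((-1) ^+ p) ((-1) ^+ q) ((-1) ^+ (p * q)) => a b c a2 b2.
  do 2![move: (three_Lie_bracket _ _ _ _ X z) => ?].
  by to_coordinates; ring: a2 b2.
- case=> [|p] // [|q] // [|r] // [P P'] [Q Q'] [R R'] _ _ _.
  case=> [P_co P'_co] [Q_co Q'_co] [R_co R'_co].
  rewrite /= in P_co P'_co Q_co Q'_co R_co R'_co.
  congr pair; rewrite /=; first exact: three_Lie_bracket_Jacobi.
  rewrite !subn1 /= in P'_co Q'_co R'_co *.
  have QR'_co := three_Lie_bracket_cochain Q_co R'_co.
  have Q'R_co := three_Lie_bracket_cochain Q'_co R_co.
  have PQ'_co := three_Lie_bracket_cochain P_co Q'_co.
  have P'Q_co := three_Lie_bracket_cochain P'_co Q_co.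
  have PR'_co := three_Lie_bracket_cochain P_co R'_co.
  have P'R_co := three_Lie_bracket_cochain P'_co R_co.
  have := three_Lie_bracket_Jacobi P_co Q_co R'_co.
  have := three_Lie_bracket_Jacobi P_co Q'_co R_co.
  have := three_Lie_bracket_Jacobi P'_co Q_co R_co.
  rewrite !subn1 !addSn !addnS /=.
  rewrite !addSn ?addnS !subn1 /= in QR'_co Q'R_co PQ'_co P'Q_co PR'_co P'R_co.
  rewrite (mulnC p.-1) sign_pred => [eqP'|p0]; last first.
    by rewrite p0 in P'_co *; rewrite (cochain0P P'_co) three_Lie_bracket0l//
      three_Lie_bracket0r.
  rewrite sign_pred => [eqQ'|q0 {eqP'}]; last first.
    rewrite q0 in Q'_co *; rewrite (cochain0P Q'_co) three_Lie_bracket0l//.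
    by have := three_Lie_bracket_cochain P_co R_co; rewrite addSn addnS subn1.
  move=> eqR'.
  rewrite !three_Lie_bracket_linear_r// three_Lie_bracket_linear_l//.
  rewrite {}eqP' {}eqQ' {}eqR'.
  apply/funext => X; apply/funext => z; rewrite !precochainE.
  rewrite !(addn0, exprS, exprD) (mulnC q p).
  move: (sign_mul_self F p) (sign_mul_self F q).
  move: ((-1) ^+ p) ((-1) ^+ q) ((-1) ^+ (p * q)) => a b c a2 b2.
  (* Opaque brackets keep the rewriting of coordinates from unfolding them. *)
  do 6![move: (three_Lie_bracket _ _ _ _ X z) => ?].
  by to_coordinates; ring: a2 b2.
Qed.

End AllArities.

(** * Maurer-Cartan elements *)

Section MaurerCartan.
Variables (F : fieldType) (L : vectType F).
Implicit Types (w : L -> L -> L -> L) (phi : 'End(L)) (f : precochain L).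

Lemma cochain_of_ternary_cochain w :
  skew_trilinear w -> cochain 2 (cochain_of_ternary w).
Proof.
case=> w1 w2 w3 w12 w23; split.
- by case=> [|[? ?] [|? ?]].
- case=> [|[x1 y1] [|U X1]] [|V X2] y z a x x' /=; rewrite ?scaler0 ?addr0//.
  exact: w1.
- case=> [|[x1 y1] [|U X1]] [|V X2] y z a x x' /=; rewrite ?scaler0 ?addr0//.
  exact: w2.
- case=> [|[x1 y1] [|U X1]] a x x' /=; rewrite ?scaler0 ?addr0//.
  exact: w3.
- by case=> [|[x1 y1] [|U X1]] [|V X2] x y z /=; rewrite ?oppr0 1?w12.
by case=> [|[x1 y1] [|U X1]] x y z /=; rewrite ?oppr0 1?w23.
Qed.

Lemma cochain_of_End_cochain phi : cochain 1 (cochain_of_End phi).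
Proof.
split.
- by case.
- by case=> [|U X1] X2 y z a x x' /=; rewrite scaler0 addr0.
- by case=> [|U X1] X2 y z a x x' /=; rewrite scaler0 addr0.
- case=> [|U X1] a x x' /=; rewrite ?scaler0 ?addr0//.
  exact: linearP.
- by case=> [|U X1] X2 x y z /=; rewrite oppr0.
by case=> [|U X1] x y z /=; rewrite oppr0.
Qed.

Lemma cochain2_ternary f : cochain 2 f ->
  exists2 w, skew_trilinear w & f = cochain_of_ternary w.
Proof.
move=> f_co; exists (fun x y z => f [:: (x, y)] z).
  split=> [y z|x z|x y|x y z|x y z].
  - exact: (cochain_linear_l f_co [::]).
  - exact: (cochain_linear_r f_co [::]).
  - exact: (cochain_linear_last f_co).
  - exact: (cochain_skew f_co [::]).
  exact: (cochain_skew_last f_co [::]).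
apply/funext => -[|[x y] [|U X]]; apply/funext => z //=;
  exact: (cochain_size f_co).
Qed.

Lemma cochain1_End f : cochain 1 f ->
  exists phi : 'End(L), f = cochain_of_End phi.
Proof.
move=> f_co.
pose f_isLinear :=
  GRing.isLinear.Build F L L _ (f [::]) (cochain_linear_last f_co [::]).
pose phi : {linear L -> L} := HB.pack (f [::]) f_isLinear.
exists (linfun phi).
apply/funext => -[|U X]; apply/funext => z.
  by rewrite -[RHS]/(linfun phi z) lfunE.
exact: (cochain_size f_co).
Qed.

(** Both components are doubled because [(w, phi)] has odd degree: the two
    compositions in a self-bracket add up instead of cancelling. *)
Lemma LieDer_bracket2 w phi : skew_trilinear w ->
  LieDer_bracket 2 2 (cochain_of_ternary w, cochain_of_End phi)
                     (cochain_of_ternary w, cochain_of_End phi) =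
  ((insertion 1 (cochain_of_ternary w) (cochain_of_ternary w)
     : precochain L) *+ 2,
   ((insertion 1 (cochain_of_End phi) (cochain_of_ternary w) : precochain L)
     - insertion 0 (cochain_of_ternary w) (cochain_of_End phi)) *+ 2).
Proof.
move=> /cochain_of_ternary_cochain w_co.
have phi_co := cochain_of_End_cochain phi.
rewrite /LieDer_bracket [(2 - 1)%N]/=.
rewrite (@three_Lie_bracketE _ _ 1 1)// (@three_Lie_bracketE _ _ 1 0)//.
rewrite (@three_Lie_bracketE _ _ 0 1)//.
rewrite /insertion_bracket.
congr pair; apply/funext => X; apply/funext => z; rewrite !precochainE.
  by rewrite mulr2n precochainE; vector_ring.
rewrite mulr2n !precochainE.
by vector_ring.
Qed.

Lemma insertion_ternary w x1 x2 x3 x4 x5 :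
  insertion 1 (cochain_of_ternary w) (cochain_of_ternary w)
      [:: (x1, x2); (x3, x4)] x5 =
    w (w x1 x2 x3) x4 x5 + w x3 (w x1 x2 x4) x5 + w x3 x4 (w x1 x2 x5)
    - w x1 x2 (w x3 x4 x5).
Proof.
rewrite /= /contract /=.
rewrite !expr1 !expr0 !scaler0 !add0r !scale1r !scaleN1r.
by rewrite addrC [X in X - _]addrC.
Qed.

Lemma insertion_End_ternary w phi x y z :
  insertion 1 (cochain_of_End phi) (cochain_of_ternary w) [:: (x, y)] z
  - insertion 0 (cochain_of_ternary w) (cochain_of_End phi) [:: (x, y)] z =
    phi (w x y z) - (w (phi x) y z + w x (phi y) z + w x y (phi z)).
Proof.
rewrite /= /contract /=.
rewrite !expr1 !expr0 !scaler0 !add0r !scale1r.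
by rewrite [X in _ - X]addrC.
Qed.

Lemma fundamental_identityP w : skew_trilinear w ->
  three_Lie_algebra w <->
  insertion 1 (cochain_of_ternary w) (cochain_of_ternary w) = 0 :> precochain L.
Proof.
move=> w_skew; have w_co := cochain_of_ternary_cochain w_skew.
have ww_co := insertion_cochain w_co w_co.
split=> [[_ w_fund]|ww0].
  apply/funext => X; apply/funext => z.
  have [size_X|size_X] := eqVneq (size X) 2%N; last exact: (cochain_size ww_co).
  case: X size_X => [|[x1 x2] [|[x3 x4] []]] // _.
  by rewrite insertion_ternary (w_fund x1 x2) subrr.
split=> // x1 x2 x3 x4 x5; apply/esym/eqP; rewrite -subr_eq0.
by rewrite -insertion_ternary ww0.
Qed.

Lemma derivationP w phi : skew_trilinear w ->
  is_derivation w phi <->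
  (insertion 1 (cochain_of_End phi) (cochain_of_ternary w) : precochain L)
    - insertion 0 (cochain_of_ternary w) (cochain_of_End phi) = 0.
Proof.
move=> w_skew; have w_co := cochain_of_ternary_cochain w_skew.
have phi_co := cochain_of_End_cochain phi.
split=> [phi_der|wphi0].
  apply/funext => X; apply/funext => z; rewrite !precochainE.
  have [size_X|size_X] := eqVneq (size X) 1%N; last first.
    rewrite (cochain_size (insertion_cochain w_co phi_co)) ?addn0//.
    by rewrite (cochain_size (insertion_cochain phi_co w_co)) ?subrr.
  case: X size_X => [|[x y] []] // _.
  by rewrite insertion_End_ternary phi_der subrr.
move=> x y z; apply/eqP; rewrite -subr_eq0 -insertion_End_ternary.
by rewrite -precochainN -precochainD wphi0.
Qed.

Lemma mulrn2_eq0 f : [pchar F] =i pred0 -> f *+ 2 = 0 -> f = 0.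
Proof.
move=> /pcharf0P charF0 /eqP; rewrite -scaler_nat.
move=> /eqP f2; rewrite -[f]scale1r -[1](@mulVf _ 2%:R) ?charF0//.
by rewrite -scalerA f2 scaler0.
Qed.

Lemma LieDer_bracket_eq0P w phi : [pchar F] =i pred0 -> skew_trilinear w ->
  LieDer_bracket 2 2 (cochain_of_ternary w, cochain_of_End phi)
                     (cochain_of_ternary w, cochain_of_End phi) = 0
  <-> three_LieDer_pair w phi.
Proof.
move=> charF0 w_skew; rewrite LieDer_bracket2//; split.
  move=> [/(mulrn2_eq0 charF0) ww0 /(mulrn2_eq0 charF0) wphi0].
  by split; [apply/fundamental_identityP|apply/derivationP].
move=> [/(fundamental_identityP w_skew) -> /(derivationP _ w_skew) ->].
by rewrite !mul0rn.
Qed.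

End MaurerCartan.

Theorem proposition2p3 (F : closedFieldType) (charF0 : [pchar F] =i pred0)
    (L : vectType F) :
  [/\ graded_Lie_bracket (@LieDer_cochain F L) (@LieDer_bracket F L),
      forall m : precochain L * precochain L,
        maurer_cartan m <->
        exists (w : L -> L -> L -> L) (phi : 'End(L)),
          three_LieDer_pair w phi
          /\ m = (cochain_of_ternary w, cochain_of_End phi)
    & forall (w : L -> L -> L -> L) (phi : 'End(L)),
        skew_trilinear w ->
        (LieDer_bracket 2 2 (cochain_of_ternary w, cochain_of_End phi)
                            (cochain_of_ternary w, cochain_of_End phi) = 0
         <-> three_LieDer_pair w phi)].
Proof.
split; first exact: LieDer_graded_Lie.
- case=> f g; split.
    case=> -[/= /cochain2_ternary[w w_skew ->] /cochain1_End[phi ->]].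
    by move=> /(LieDer_bracket_eq0P phi charF0 w_skew) ?; exists w, phi.
  case=> w [phi [w_phi ->]]; have [[w_skew _] _] := w_phi; split.
    by split; [exact: cochain_of_ternary_cochain|exact: cochain_of_End_cochain].
  exact/LieDer_bracket_eq0P.
by move=> w phi; apply: LieDer_bracket_eq0P.
Qed.
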